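(* Let $R$ be a Noetherian ring and $E$ a finitely generated torsionfree $R$-module of rank $e>0$ with $E\subseteq G\cong R^e$. The following are equivalent: (a) $\operatorname{grade}(G/E)\ge2$; (b) $\operatorname{grade}(G/U)\ge2$ for every reduction $U$ of $E$; (c) $\operatorname{grade}(G/U)\ge 2$ for some reduction $U$ of $E$. If these hold, then for every reduction $U$ of $E$, $V(F_e(E))=V(F_e(U))=\operatorname{Supp}(G/E)=\operatorname{Supp}(G/U)$, and in particular $\operatorname{grade}(G/E)=\operatorname{grade}F_e(E)=\operatorname{grade}F_e(U)=\operatorname{grade}(G/U)$.
   Context: All rings are commutative and Noetherian. A finitely generated module has rank $e$ if $E\otimes_RQ\cong Q^e$, $Q$ the total ring of fractions. For $E$ finitely generated torsionfree of rank $e>0$ with $E\subseteq G=R^e$, the Rees algebra $\mathcal R(E)$ is the $R$-subalgebra of $R[t_1,\dots,t_e]$ generated by the linear forms $a_1t_1+\dots+a_et_e$, $(a_1,\dots,a_e)\in E$, and $E^n$ is its degree-$n$ component. A submodule $U\subseteq E$ is a reduction of $E$ if $E^{r+1}=U\cdot E^r$ in $\mathcal R(E)$ for some $r\ge0$ (a reduction again has rank $e$). $F_i(E)$ is the $i$-th Fitting ideal (generated by the $(n-i)$-minors of a presentation matrix $R^m\to R^n$ of $E$). For a finitely generated module $M$, $\operatorname{grade}M$ is the grade of $\operatorname{ann}_RM$ ($\infty$ if $M=0$). *)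

(* Defs.v *)
From HB Require Import structures.
From mathcomp Require Import all_boot all_order all_algebra.
Set Implicit Arguments. Unset Strict Implicit. Unset Printing Implicit Defensive.
Import GRing.Theory.
Local Open Scope ring_scope.

Section CommAlg.
Variable R : comPzRingType.

Definition ideal (I : R -> Prop) : Prop :=
  [/\ I 0, (forall x y, I x -> I y -> I (x + y)) & (forall r x, I x -> I (r * x))].

Definition ideal_of (s : seq R) (y : R) : Prop :=
  exists c : nat -> R, y = \sum_(i < size s) c i * s`_i.

Definition noetherian : Prop :=
  forall I : R -> Prop, ideal I -> exists s : seq R, forall x, I x <-> ideal_of s x.

Definition prime_ideal (P : R -> Prop) : Prop :=
  [/\ ideal P, ~ P 1 & forall x y, P (x * y) -> P x \/ P y].

Definition nonzerodivisor (r : R) : Prop := forall y, r * y = 0 -> y = 0.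

Definition regular_seq (xs : seq R) : Prop :=
  (forall i, (i < size xs)%N ->
     forall y, ideal_of (take i xs) (xs`_i * y) -> ideal_of (take i xs) y)
  /\ ~ ideal_of xs 1.

(* grade I >= k   (grade I = infinity when I = R) *)
Definition grade_ge (I : R -> Prop) (k : nat) : Prop :=
  I 1 \/ exists xs : seq R, [/\ size xs = k, (forall x, x \in xs -> I x) & regular_seq xs].

Definition grade_eq (I J : R -> Prop) : Prop := forall k, grade_ge I k <-> grade_ge J k.

Definition in_V (I P : R -> Prop) : Prop := forall x, I x -> P x.

Variable e : nat.
Notation vec := 'rV[R]_e.

Definition submod (E : vec -> Prop) : Prop :=
  [/\ E 0, (forall u v, E u -> E v -> E (u + v)) & (forall r v, E v -> E (r *: v))].

Definition fingen (E : vec -> Prop) : Prop :=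
  exists n (Gm : 'M[R]_(n, e)), forall v, E v <-> exists c : 'rV[R]_n, v = c *m Gm.

Definition torsionfree (E : vec -> Prop) : Prop :=
  forall r v, nonzerodivisor r -> E v -> r *: v = 0 -> v = 0.

(* rank e for E inside R^e: E (x) Q = Q^e inside Q^e, Q total ring of fractions,
   i.e. every v in R^e becomes (over Q) an element of Q E *)
Definition rank_full (E : vec -> Prop) : Prop :=
  forall v : vec, exists s, nonzerodivisor s /\ E (s *: v).

Definition ann_quot (E : vec -> Prop) (r : R) : Prop := forall v : vec, E (r *: v).

(* P in Supp(G/E):  (G/E)_P <> 0 *)
Definition in_supp_quot (E : vec -> Prop) (P : R -> Prop) : Prop :=
  exists v : vec, forall s, ~ P s -> ~ E (s *: v).

Definition presents (E : vec -> Prop) n m (Gm : 'M[R]_(n, e)) (A : 'M[R]_(m, n)) : Prop :=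
  (forall v, E v <-> exists c : 'rV[R]_n, v = c *m Gm) /\
  (forall c : 'rV[R]_n, c *m Gm = 0 <-> exists d : 'rV[R]_m, c = d *m A).

Definition fitting (i : nat) n m (A : 'M[R]_(m, n)) (r : R) : Prop :=
  exists c : {ffun {ffun 'I_(n - i) -> 'I_m} * {ffun 'I_(n - i) -> 'I_n} -> R},
    r = \sum_(fg : {ffun 'I_(n - i) -> 'I_m} * {ffun 'I_(n - i) -> 'I_n})
          c fg * \det (\matrix_(a, b) A (fg.1 a) (fg.2 b)).

(* polynomials in t_1..t_e are coefficient functions on monomials (exponent vectors) *)
Definition monomial := {ffun 'I_e -> nat}.

(* coefficients of the product of the linear forms  sum_j (vs k)_j t_j, k < n *)
Definition linprod n (vs : {ffun 'I_n -> vec}) (mo : monomial) : R :=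
  \sum_(s : {ffun 'I_n -> 'I_e} | [forall j, #|[pred k | s k == j]| == mo j])
     \prod_(k < n) vs k 0 (s k).

Definition prod_span n (Ps : 'I_n -> vec -> Prop) (f : monomial -> R) : Prop :=
  exists l : seq (R * {ffun 'I_n -> vec}),
    (forall p, p \in l -> forall k, Ps k (p.2 k)) /\
    (forall mo, f mo = \sum_(p <- l) p.1 * linprod p.2 mo).

(* E^n : degree-n component of R(E) *)
Definition rees_pow (E : vec -> Prop) n : (monomial -> R) -> Prop :=
  prod_span (fun _ : 'I_n => E).

Definition rees_mul (U E : vec -> Prop) r : (monomial -> R) -> Prop :=
  prod_span (fun k : 'I_r.+1 => if val k == 0%N then U else E).

Definition reduction (U E : vec -> Prop) : Prop :=
  [/\ submod U, (forall v, U v -> E v) &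
      exists r : nat, forall f, rees_pow E r.+1 f <-> rees_mul U E r f].

End CommAlg.

(* Main.v *)
(** The annihilators of [G/E] and [G/U] have the same radical, which is also that of the
    Fitting ideals once the grade is at least two.  Grade and [V] only depend on the
    radical, since powers of a regular sequence form a regular sequence.

    If [x] kills [G/E], then [(x t_j)^(r+1)] lies in [E^(r+1) = U E^r]; evaluating at
    [t = a] puts [(x a_j)^(r+1)] in the ideal of all [u.a] with [u] in [U], for every
    point [a], and eliminating one coordinate at a time gives [x^N G <= U].

    For the Fitting ideal, where [x] kills [G/E] the module [E] is locally free of rank
    [e].  Conversely, where a minor of size [n - e] is inverted, [E] is generated by [e]
    elements, so [G/E] is presented by a square matrix; its determinant generates an ideal
    which, up to radical, contains [ann (G/E)], and a principal ideal generated by a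
    non-unit has no regular sequence of length two up to radical. *)
Require Import Defs.
From HB Require Import structures.
From mathcomp Require Import all_boot all_order all_algebra.
From mathcomp Require Import ring.
From Stdlib Require Import Classical.
Set Implicit Arguments. Unset Strict Implicit. Unset Printing Implicit Defensive.
Import GRing.Theory.
Local Open Scope ring_scope.

(** * Regular sequences modulo an ideal, and grade up to radical *)

Section Ideals.
Variable R : comPzRingType.
Implicit Types (I J K : R -> Prop) (s xs : seq R).

Definition radical I (x : R) : Prop := exists n, I (x ^+ n).

Lemma idealN I x : ideal I -> I x -> I (- x).
Proof. by case=> _ _ IM /(IM (- 1)); rewrite mulN1r. Qed.

Lemma idealB I x y : ideal I -> I x -> I y -> I (x - y).
Proof. by move=> idI Ix Iy; case: (idI) => _ + _; apply=> //; apply: idealN. Qed.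

Lemma ideal_exp_le I m n x : ideal I -> (m <= n)%N -> I (x ^+ m) -> I (x ^+ n).
Proof. by case=> _ _ IM /subnK <- Ix; rewrite exprD; apply: IM. Qed.

Lemma ideal_sum I (T : finType) (F : T -> R) :
  ideal I -> (forall i, I (F i)) -> I (\sum_i F i).
Proof. by case=> I0 ID _ IF; elim/big_ind: _. Qed.

Lemma ideal_of_ideal s : ideal (ideal_of s).
Proof.
split=> [|x y [c ->] [d ->]|r x [c ->]].
- by exists (fun=> 0); rewrite big1 // => i _; rewrite mul0r.
- exists (fun i => c i + d i); rewrite -big_split /=.
  by apply: eq_bigr => i _; rewrite mulrDl.
- exists (fun i => r * c i); rewrite mulr_sumr.
  by apply: eq_bigr => i _; rewrite mulrA.
Qed.

Lemma ideal_of_min s J x : ideal J -> {in s, forall y, J y} -> ideal_of s x -> J x.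
Proof.
move=> idJ sJ [c ->]; case: (idJ) => _ _ JM; apply: ideal_sum => // i.
by apply/JM/sJ/mem_nth.
Qed.

Lemma mem_ideal_of s x : x \in s -> ideal_of s x.
Proof.
move=> xs; have ixs : (index x s < size s)%N by rewrite index_mem.
exists (fun i => (i == index x s)%:R).
rewrite (bigD1 (Ordinal ixs)) //= eqxx mul1r nth_index // big1 ?addr0 // => i.
by rewrite -val_eqE /= => /negPf ->; rewrite mul0r.
Qed.

Lemma prime_ideal_exp I P x :
  prime_ideal P -> (forall y, I y -> P y) -> radical I x -> P x.
Proof.
case=> _ P1 PM IP [n /IP]; elim: n => [|n IHn]; first by rewrite expr0.
by rewrite exprS => /PM[|/IHn].
Qed.

(** The ideal [K + (x)], kept as a predicate so that regular sequences can be treated by recursion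
    on the list. *)
Definition adjoin K (x : R) (z : R) : Prop := exists c, K (z - c * x).

Lemma adjoin_ideal K x : ideal K -> ideal (adjoin K x).
Proof.
case=> K0 KD KM; split; first by exists 0; rewrite mul0r subr0.
- move=> y z [c Kc] [d Kd]; exists (c + d).
  by have := KD _ _ Kc Kd; congr K; ring.
- move=> r y [c Kc]; exists (r * c).
  by have := KM r _ Kc; congr K; ring.
Qed.

Lemma ideal_of_rcons s x z : ideal_of (rcons s x) z <-> adjoin (ideal_of s) x z.
Proof.
split=> [[c ->]|[c]].
  exists (c (size s)); exists c; rewrite size_rcons big_ord_recr /= nth_rcons.
  rewrite ltnn eqxx addrK; apply: eq_bigr => i _.
  by rewrite nth_rcons ltn_ord.
have idL := ideal_of_ideal (rcons s x); case: (idL) => _ LD LM.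
move=> /(@ideal_of_min _ (ideal_of (rcons s x)) _ idL) H.
rewrite -[z](subrK (c * x)); apply: LD.
  by apply: H => y ys; apply: mem_ideal_of; rewrite mem_rcons inE ys orbT.
by apply/LM/mem_ideal_of; rewrite mem_rcons inE eqxx.
Qed.

Definition reg_mod K (x : R) : Prop := forall y, K (x * y) -> K y.

(** Weakly regular sequences on [R/K]: the quotient by the whole sequence may vanish. *)
Fixpoint reg_seq_mod K xs : Prop :=
  if xs is x :: xs' then reg_mod K x /\ reg_seq_mod (adjoin K x) xs' else True.

Lemma reg_seq_mod_ext K K' xs :
  (forall z, K z <-> K' z) -> reg_seq_mod K xs -> reg_seq_mod K' xs.
Proof.
elim: xs K K' => //= x xs IH K K' KK' [Kx Kxs]; split.
  by move=> y /KK' /Kx /KK'.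
by apply: IH Kxs => z; split=> -[c /KK' ?]; exists c.
Qed.

Lemma reg_seq_mod_ideal_of s xs :
  reg_seq_mod (ideal_of s) xs <->
  forall i, (i < size xs)%N -> reg_mod (ideal_of (s ++ take i xs)) xs`_i.
Proof.
elim: xs s => [|x xs IH] s //=.
have ext := fun z => ideal_of_rcons s x z.
split=> [[Kx Kxs] [|i] ltin|H].
- by rewrite cats0.
- rewrite /= -cat_rcons; apply: (iffLR (IH _)) => //.
  by apply: reg_seq_mod_ext Kxs => z; rewrite ext.
- split; first by have := H 0%N isT; rewrite /= cats0.
  apply: reg_seq_mod_ext ext _; apply/IH => i ltin.
  by rewrite cat_rcons; apply: (H i.+1).
Qed.

(** If [a y = c x] modulo [K], regularity of [x] modulo [K + (a)] gives [c = d a], and cancelling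
    [a] leaves [y = d x]. *)
Lemma reg_mod_adjoin K a x :
  ideal K -> reg_mod K a -> reg_mod (adjoin K a) x -> reg_mod (adjoin K x) a.
Proof.
move=> idK Ka Kax y [c Kc].
have [|d Kd] := Kax c.
  by exists y; have := idealN idK Kc; congr K; ring.
exists d; apply: Ka; case: (idK) => _ KD KM.
by have := KD _ _ Kc (KM x _ Kd); congr K; ring.
Qed.

(** Induction on [xs] absorbs its head into the base ideal, over which [a] and [b] stay regular by
    [reg_mod_adjoin]. *)
Lemma reg_seq_mod_mul K a b xs :
  ideal K -> reg_mod K a -> reg_mod K b ->
  reg_seq_mod (adjoin K a) xs -> reg_seq_mod (adjoin K b) xs ->
  reg_seq_mod (adjoin K (a * b)) xs.
Proof.
elim: xs K => //= x xs IH K idK Ka Kb [Kax Kaxs] [Kbx Kbxs].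
have swap u v z : adjoin (adjoin K u) v z <-> adjoin (adjoin K v) u z.
  by split=> -[c [d]]; rewrite addrAC; exists d, c.
case: (idK) => _ KD KM; split.
  move=> y [c Kc]; have [|d Kd] := Kax y.
    by exists (c * b); have := Kc; congr K; ring.
  have [|f Kf] := Kbx d.
    exists c; apply: Ka.
    by have := idealB idK Kc (KM x _ Kd); congr K; ring.
  by exists f; have := KD _ _ Kd (KM a _ Kf); congr K; ring.
apply: (reg_seq_mod_ext (swap _ _)); apply: IH.
- exact: adjoin_ideal.
- exact: reg_mod_adjoin.
- exact: reg_mod_adjoin.
- exact: reg_seq_mod_ext (swap _ _) Kaxs.
- exact: reg_seq_mod_ext (swap _ _) Kbxs.
Qed.

Lemma reg_mod_exp K x n : reg_mod K x -> reg_mod K (x ^+ n).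
Proof.
move=> Kx; elim: n => [|n IH] y; first by rewrite mul1r.
by rewrite exprS -mulrA => /Kx /IH.
Qed.

Lemma reg_seq_mod_exp K xs n :
  ideal K -> reg_seq_mod K xs -> reg_seq_mod K [seq x ^+ n.+1 | x <- xs].
Proof.
elim: xs K => //= x xs IH K idK [Kx Kxs]; split; first exact: reg_mod_exp.
have {}IH := IH _ (adjoin_ideal x idK) Kxs.
(* Only the exponent of the head varies here; the tail keeps the exponent [n.+1]. *)
elim: {1}n => [|m IHm]; first by rewrite expr1.
by rewrite exprS; apply: reg_seq_mod_mul => //; apply: reg_mod_exp.
Qed.

Lemma regular_seq_exp xs n : regular_seq xs -> regular_seq [seq x ^+ n.+1 | x <- xs].
Proof.
case=> regxs nxs; split.
  apply: (iffLR (reg_seq_mod_ideal_of [::] _)).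
  apply: reg_seq_mod_exp; first exact: ideal_of_ideal.
  exact/reg_seq_mod_ideal_of.
apply: contra_not nxs; apply: ideal_of_min; first exact: ideal_of_ideal.
move=> _ /mapP[x xxs ->]; rewrite exprSr.
by case: (ideal_of_ideal xs) => _ _; apply; apply: mem_ideal_of.
Qed.

Lemma grade_ge_radical I J k :
  ideal J -> (forall x, I x -> radical J x) -> grade_ge I k -> grade_ge J k.
Proof.
move=> idJ IJ [/IJ[n]|[xs [szxs Ixs regxs]]]; first by rewrite expr1n; left.
(* The sequence is finite, so one exponent serves all its entries. *)
have [n Jn] : exists n, {in xs, forall x, J (x ^+ n)}.
  elim: xs Ixs {szxs regxs} => [|x xs IH] Ixs; first by exists 0%N.
  have [|n Jn] := IH; first by move=> y yxs; apply: Ixs; rewrite inE yxs orbT.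
  have [|m Jm] := IJ x; first by apply: Ixs; rewrite mem_head.
  exists (maxn m n) => y; rewrite inE => /predU1P[->|/Jn].
    by apply: ideal_exp_le Jm => //; rewrite leq_maxl.
  by apply: ideal_exp_le => //; rewrite leq_maxr.
right; exists [seq x ^+ n.+1 | x <- xs]; split; first by rewrite size_map.
  by move=> _ /mapP[x /Jn Jx ->]; apply: ideal_exp_le Jx.
exact: regular_seq_exp.
Qed.

Lemma grade_ge2_regular I :
  grade_ge I 2 -> I 1 \/ exists x y,
    [/\ I x, I y, nonzerodivisor x & reg_mod (adjoin (ideal_of [::]) x) y].
Proof.
case=> [|[xs []]]; first by left.
case: xs => [|x [|y []]] // _ Ixs [regxs _].
right; exists x, y; split.
- by apply: Ixs; rewrite mem_head.
- by apply: Ixs; rewrite !inE eqxx orbT.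
- move=> z xz0; have [|c ->] := regxs 0%N isT z; last by rewrite big_ord0.
  by exists (fun=> 0); rewrite big_ord0.
- by case/(iffRL (reg_seq_mod_ideal_of [::] _)): regxs => _ [].
Qed.

Lemma radical_ideal_add I x y :
  ideal I -> radical I x -> radical I y -> radical I (x + y).
Proof.
move=> idI [m Ix] [n Iy]; exists (m + n)%N; rewrite exprDn.
case: (idI) => I0 ID IM; apply: ideal_sum => // i.
rewrite -mulr_natl; apply: (IM); case: (leqP n i) => [|ltin].
  by move=> /(ideal_exp_le idI) H; apply/(IM)/H.
rewrite mulrC; apply: (IM); apply: (ideal_exp_le idI) Ix.
by rewrite -addnBA ?leq_addr // ltnW.
Qed.

End Ideals.

(** * Values of linear forms, annihilators of reductions, and supports *)

Section Reductions.
Variable R : comPzRingType.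

(** The value at the point [t = a] of the linear form with coefficient vector [u]. *)
Definition dot e (u a : 'rV[R]_e) : R := \sum_j u 0 j * a 0 j.

Lemma dotDl e (u v a : 'rV[R]_e) : dot (u + v) a = dot u a + dot v a.
Proof. by rewrite /dot -big_split; apply: eq_bigr => j _; rewrite mxE mulrDl. Qed.

Lemma dotZl e r (u a : 'rV[R]_e) : dot (r *: u) a = r * dot u a.
Proof. by rewrite /dot mulr_sumr; apply: eq_bigr => j _; rewrite mxE mulrA. Qed.

Lemma dotZr e r (u a : 'rV[R]_e) : dot u (r *: a) = r * dot u a.
Proof. by rewrite /dot mulr_sumr; apply: eq_bigr => j _; rewrite mxE mulrCA. Qed.

Lemma dot_delta e (a : 'rV[R]_e) j : dot (delta_mx 0 j) a = a 0 j.
Proof.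
rewrite /dot (bigD1 j) //= big1 ?addr0 => [|i /negPf ij]; last first.
  by rewrite mxE ij andbF mul0r.
by rewrite mxE !eqxx mul1r.
Qed.

Lemma dot_row_mx e1 e2 (u a : 'rV[R]_e1) (v b : 'rV[R]_e2) :
  dot (row_mx u v) (row_mx a b) = dot u a + dot v b.
Proof.
by rewrite /dot big_split_ord; congr (_ + _); apply: eq_bigr => j _;
  rewrite ?row_mxEl ?row_mxEr.
Qed.

Lemma ann_quotP e (E : 'rV[R]_e -> Prop) r :
  submod E -> (forall j, E (r *: delta_mx 0 j)) -> ann_quot E r.
Proof.
case=> E0 ED EZ Er v; rewrite (row_sum_delta v) scaler_sumr.
by elim/big_ind: _ => // j _; rewrite scalerA mulrC -scalerA; apply: EZ.
Qed.

Lemma ann_quot_ideal e (E : 'rV[R]_e -> Prop) : submod E -> ideal (ann_quot E).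
Proof.
case=> E0 ED EZ; split=> [v|x y Ex Ey v|r x Ex v]; first by rewrite scale0r.
  by rewrite scalerDl; apply: ED.
by rewrite -scalerA; apply: EZ.
Qed.

(* Evaluation at [t = a] of a form of degree at most [n]. *)
Definition form_eval e n (f : monomial e -> R) (a : 'rV[R]_e) : R :=
  \sum_(mo : {ffun 'I_e -> 'I_n.+1})
     f [ffun j => val (mo j)] * \prod_j a 0 j ^+ mo j.

Lemma form_eval_linprod e n (vs : {ffun 'I_n -> 'rV[R]_e}) a :
  form_eval n (linprod vs) a = \prod_k dot (vs k) a.
Proof.
rewrite /dot bigA_distr_bigA /= /form_eval /linprod.
under [LHS]eq_bigr do rewrite mulr_suml.
rewrite (exchange_big_dep xpredT) //=; apply: eq_bigr => s _.
have cnt_le j : (#|[pred k | s k == j]| < n.+1)%N.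
  by rewrite ltnS (leq_trans (max_card _)) ?card_ord.
(* A choice [s] of one variable per factor contributes to a single monomial, whose exponents are the
   fibre sizes of [s]. *)
pose ms : {ffun 'I_e -> 'I_n.+1} := [ffun j => Ordinal (cnt_le j)].
rewrite (big_pred1 ms) => [|mo]; last first.
  apply/forallP/eqP => [Hmo|-> j]; last by rewrite !ffunE.
  by apply/ffunP => j; apply: val_inj; have /eqP := Hmo j; rewrite !ffunE.
rewrite big_split; congr (_ * _).
rewrite [RHS](partition_big s xpredT) //=; apply: eq_bigr => j _.
rewrite ffunE /= (eq_bigr (fun=> a 0 j)) => [|k /eqP -> //].
by rewrite prodr_const.
Qed.

Lemma form_eval_prod_span e n (Ps : 'I_n -> 'rV[R]_e -> Prop) f a (I : R -> Prop) k :
  ideal I -> (forall u, Ps k u -> I (dot u a)) -> prod_span Ps f ->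
  I (form_eval n f a).
Proof.
move=> idI IPs [l [Pl fE]].
have -> : form_eval n f a = \sum_(p <- l) p.1 * form_eval n (linprod p.2) a.
  rewrite /form_eval; under eq_bigr do rewrite fE mulr_suml.
  rewrite exchange_big; apply: eq_bigr => p _; rewrite mulr_sumr.
  by apply: eq_bigr => mo _; rewrite mulrA.
case: (idI) => I0 ID IM; rewrite big_seq; elim/big_ind: _ => // p pl.
apply: (IM); rewrite form_eval_linprod (bigD1 k) //= mulrC.
by apply/IM/IPs/Pl.
Qed.

Lemma reduction_dot e (U E : 'rV[R]_e -> Prop) x a j :
  reduction U E -> ann_quot E x ->
  exists n u, U u /\ dot u a = (x * a 0 j) ^+ n.
Proof.
move=> [[U0 UD UZ] _ [r redU]] Ex.
(* The product of these forms is [(x t_j)^(r+1)]. *)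
pose vs : {ffun 'I_r.+1 -> 'rV[R]_e} := [ffun=> x *: delta_mx 0 j].
have /redU : rees_pow E r.+1 (linprod vs).
  exists [:: (1, vs)]; split=> [p|mo]; last by rewrite big_seq1 mul1r.
  by rewrite inE => /eqP -> k; rewrite ffunE.
pose I z := exists u, U u /\ dot u a = z.
have idI : ideal I.
  split=> [|_ _ [u [Uu <-]] [v [Uv <-]]|c _ [u [Uu <-]]].
  - by exists 0; split=> //; rewrite /dot big1 // => i _; rewrite mxE mul0r.
  - by exists (u + v); rewrite dotDl; split=> //; apply: UD.
  - by exists (c *: u); rewrite dotZl; split=> //; apply: UZ.
(* The factor of index [ord0] is the one that [rees_mul] takes from [U]. *)
move/(@form_eval_prod_span _ _ _ _ a I ord0 idI) => /(_ _)[u|u [Uu]].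
  by exists u.
rewrite form_eval_linprod => uE; exists r.+1, u; split=> //.
rewrite uE (eq_bigr (fun=> x * a 0 j)); first by rewrite prodr_const card_ord.
by move=> k _; rewrite ffunE dotZl dot_delta.
Qed.

(* Splitting off the first coordinate: if [u = (x ^ n, w)] lies in [U], then pairing
   with [(- w.a, x ^ n a)] transfers the hypothesis to [U] meet [0 x R^e]. *)
Lemma radical_ann_quot_dot e (U : 'rV[R]_e -> Prop) x :
  submod U ->
  (forall a j, exists m n u, U u /\ dot u a = x ^+ m * a 0 j ^+ n) ->
  radical (ann_quot U) x.
Proof.
elim: e U => [|e IHe] U subU Udot.
  by exists 0%N => v; rewrite [_ *: v]thinmx0; case: subU.
move: U subU Udot; rewrite -[e.+1]/(1 + e)%N => U subU Udot.
case: (subU) => U0 UD UZ.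
have UB u v : U u -> U v -> U (u - v).
  by move=> Uu Uv; apply: UD => //; rewrite -scaleN1r; apply: UZ.
(* At the point [(1, 0)] the form takes its first coefficient as value, and the power of the
   coordinate is 1. *)
have [N [w Uw]] : exists N w, U (row_mx (x ^+ N)%:M w).
  have [m [n [u [Uu]]]] := Udot (row_mx 1%:M 0) (lshift e 0).
  rewrite row_mxEl mxE eqxx expr1n mulr1 -[u]hsubmxK dot_row_mx.
  have -> : dot (rsubmx u) 0 = 0 by rewrite -(scale0r 0) dotZr mul0r.
  rewrite /dot big_ord1 addr0 [1%:M _ _]mxE eqxx mulr1 => uE.
  by exists m, (rsubmx u); rewrite -uE -mx11_scalar hsubmxK.
pose U' (v : 'rV[R]_e) := U (row_mx 0 v).
have subU' : submod U'.
  split=> [|u v Uu Uv|r v Uv]; rewrite /U' ?row_mx0 //.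
    by rewrite -[0]addr0 -add_row_mx; apply: UD.
  by rewrite -(scaler0 _ r) -scale_row_mx; apply: UZ.
have [a j|N' U'N'] := IHe U' subU'.
  have [m [n [u [Uu]]]] := Udot (row_mx (- dot w a)%:M (x ^+ N *: a)) (rshift 1 j).
  rewrite -[u in dot u _]hsubmxK dot_row_mx row_mxEr mxE {1}/dot big_ord1.
  rewrite [_%:M _ _]mxE eqxx mulr1n dotZr => uE.
  (* The coordinate of the new point is [x^N a_j], whose [n]-th power adds [N n] to the exponent of
     [x]; hence the separate exponents [m] and [n]. *)
  exists (m + N * n)%N, n, (x ^+ N *: rsubmx u - lsubmx u 0 0 *: w); split.
    have := UB _ _ (UZ (x ^+ N) _ Uu) (UZ (lsubmx u 0 0) _ Uw).
    rewrite -{1}[u]hsubmxK !scale_row_mx opp_row_mx add_row_mx; congr (U (row_mx _ _)).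
    by apply/rowP => i; rewrite !mxE !ord1 eqxx mulr1n mulrC subrr.
  rewrite dotDl -scaleNr !dotZl exprD exprM -mulrA -exprMn -uE; ring.
exists (N' + N)%N => v; rewrite -[v]hsubmxK scale_row_mx exprD.
(* Write [v = (v0, v1)]: then [x^(N'+N) v = x^N' (0, x^N v1 - v0 w) + x^N' v0 (x^N, w)]. *)
have Uv := U'N' (x ^+ N *: rsubmx v - lsubmx v 0 0 *: w).
have := UD _ _ Uv (UZ (x ^+ N' * lsubmx v 0 0) _ Uw).
rewrite scale_row_mx add_row_mx; congr (U (row_mx _ _)).
  by apply/rowP => i; rewrite !mxE !ord1 eqxx mulr1n add0r; ring.
by apply/rowP => i; rewrite !mxE; ring.
Qed.

Lemma reduction_radical_ann e (U E : 'rV[R]_e -> Prop) x :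
  reduction U E -> ann_quot E x -> radical (ann_quot U) x.
Proof.
move=> redU Ex; have [subU _ _] := redU.
apply: radical_ann_quot_dot => // a j.
have [n [u [Uu uE]]] := reduction_dot a j redU Ex.
by exists n, n, u; rewrite uE exprMn.
Qed.

Lemma reduction_refl e (E : 'rV[R]_e -> Prop) : submod E -> reduction E E.
Proof.
move=> subE; split=> //; exists 0%N => f.
by split=> -[l [lE fE]]; exists l; split=> // p /lE pE k; have := pE k; case: ifP.
Qed.

Lemma ann_quot_sub e (U E : 'rV[R]_e -> Prop) x :
  (forall v, U v -> E v) -> ann_quot U x -> ann_quot E x.
Proof. by move=> UE Ux v; apply: UE. Qed.

(** If the localization vanishes, each basis vector has a multiplier outside [P] taking it into [E];
    the product of these finitely many multipliers kills the quotient and lies outside [P]. *)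
Lemma in_supp_quotE e (E : 'rV[R]_e -> Prop) P :
  submod E -> prime_ideal P -> in_supp_quot E P <-> in_V (ann_quot E) P.
Proof.
move=> subE primeP; split=> [[v Ev] x Ex|annP].
  by apply: NNPP => /Ev; apply; apply: Ex.
apply: NNPP => nsupp; case: (subE) => _ _ EZ.
have loc v : exists s, ~ P s /\ E (s *: v).
  apply: NNPP => nE; apply: nsupp; exists v => s Ps Es.
  by apply: nE; exists s.
have [s sE] := fin_all_exists (fun j : 'I_e => loc (delta_mx 0 j)).
have : P (\prod_j s j).
  apply: annP; apply: ann_quotP => // j; rewrite (bigD1 j) //= mulrC -scalerA.
  by apply/EZ/(sE j).2.
case: primeP => _ P1 PM; elim/big_rec: _ => [//|j y _ Py /PM[]//].
exact: (sE j).1.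
Qed.

End Reductions.

(** * Fitting ideals and annihilators *)

Section FittingIdeals.
Variable R : comPzRingType.

Lemma fitting_ideal p m n (A : 'M[R]_(m, n)) : ideal (fitting p A).
Proof.
split=> [|_ _ [c ->] [d ->]|r _ [c ->]].
- by exists [ffun=> 0]; rewrite big1 // => i _; rewrite ffunE mul0r.
- exists [ffun fg => c fg + d fg]; rewrite -big_split /=.
  by apply: eq_bigr => fg _; rewrite ffunE mulrDl.
- exists [ffun fg => r * c fg]; rewrite mulr_sumr.
  by apply: eq_bigr => fg _; rewrite ffunE mulrA.
Qed.

Lemma fitting_minor p m n (A : 'M[R]_(m, n)) k (f : 'I_k -> 'I_m) (g : 'I_k -> 'I_n) :
  k = (n - p)%N -> fitting p A (\det (mxsub f g A)).
Proof.
move=> kE; subst k; exists [ffun fg => (fg == ([ffun i => f i], [ffun i => g i]))%:R].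
rewrite (bigD1 ([ffun i => f i], [ffun i => g i])) //= ffunE eqxx mul1r.
rewrite big1 ?addr0 => [|fg /negPf nfg]; last by rewrite ffunE nfg mul0r.
by congr (\det _); apply/matrixP => i j; rewrite !mxE !ffunE.
Qed.

(* [h i = Some a] records that row [i] of [X] is row [a] of [A] (with columns chosen by
   [g]); Laplace expansion along the other rows reduces to a minor of [A]. *)
Lemma fitting_det p m n (A : 'M[R]_(m, n)) k (X : 'M[R]_k)
    (h : 'I_k -> option 'I_m) (g : 'I_k -> 'I_n) :
  (forall i a, h i = Some a -> forall j, X i j = A a (g j)) ->
  (n - p <= \sum_i isSome (h i))%N -> fitting p A (\det X).
Proof.
have minor l (Y : 'M_l) h' (g' : 'I_l -> 'I_n) :
    (forall i a, h' i = Some a -> forall j, Y i j = A a (g' j)) ->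
    [forall i, isSome (h' i)] -> l = (n - p)%N -> fitting p A (\det Y).
  move=> h'Y /forallP h'T lE.
  have /fin_all_exists[f fE] : forall i, exists a, h' i = Some a.
    by move=> i; have := h'T i; case: (h' i) => // a _; exists a.
  have -> : Y = mxsub f g' A by apply/matrixP => i j; rewrite mxE (h'Y _ _ (fE i)).
  exact: fitting_minor.
elim: k X h g => [|k IHk] X h g hX.
  rewrite big_ord0 leqn0 => /eqP q0; apply: (minor _ _ h g hX) => //.
  by apply/forallP => -[].
move=> le_q; have [kq|k_neq_q] := eqVneq k.+1 (n - p)%N.
  apply: (minor _ _ h g hX) => //; apply/forallP => i; apply: contraTT le_q => hi.
  rewrite -ltnNge -kq ltnS (bigD1_ord i) //= (negPf hi) add0n.
  by rewrite -[leqRHS]card_ord -sum1_card; apply: leq_sum => j _; case: isSome.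
(* Expand along a row not known to come from [A]; if there is none, any row can be spared, since
   [k.+1] exceeds [n - p]. *)
have [i0 le_q0] : exists i0, (n - p <= \sum_i isSome (h (lift i0 i)))%N.
  have [/forallP hT|/forallPn[i hi]] := boolP [forall i, isSome (h i)].
    exists ord0; rewrite (eq_bigr (fun=> 1%N)) => [|i _]; last by rewrite hT.
    rewrite sum1_card card_ord -ltnS ltn_neqAle eq_sym k_neq_q (leq_trans le_q) //.
    by rewrite -[leqRHS]card_ord -sum1_card; apply: leq_sum => j _; case: isSome.
  by exists i; move: le_q; rewrite (bigD1_ord i) //= (negPf hi).
rewrite (expand_det_row X i0); have idF := fitting_ideal p A.
case: (idF) => _ _ FM; apply: ideal_sum => // j; apply/(FM)/(FM).
apply: (IHk _ (h \o lift i0) (g \o lift j)) => // i a ha l.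
by rewrite !mxE; apply: hX.
Qed.

(** Cauchy-Binet before grouping: [f] runs over all functions, and the non-injective ones repeat a
    row of [Q]. *)
Lemma det_mulmx_rect n k (P : 'M[R]_(n, k)) (Q : 'M[R]_(k, n)) :
  \det (P *m Q) =
  \sum_(f : {ffun 'I_n -> 'I_k}) (\prod_i P i (f i)) * \det (rowsub f Q).
Proof.
under [RHS]eq_bigr do rewrite mulr_sumr.
rewrite exchange_big; apply: eq_bigr => s _ /=.
under [RHS]eq_bigr do rewrite mulrCA.
rewrite -mulr_sumr; congr (_ * _).
under eq_bigr do rewrite mxE.
rewrite bigA_distr_bigA; apply: eq_bigr => f _; rewrite big_split /=.
by congr (_ * _); apply: eq_bigr => i _; rewrite mxE.
Qed.

Variable e : nat.
Implicit Types (E : 'rV[R]_e -> Prop).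

(* If [x] kills [G/E], then [x = B Gm] and [x - Gm B = D A] for some [B] and [D], so that
   [x^n] is the determinant of the product of [(D | Gm)] and the stack of [A] and [B]. *)
Lemma ann_quot_fitting E n m (Gm : 'M[R]_(n, e)) (A : 'M[R]_(m, n)) x :
  presents E Gm A -> ann_quot E x -> radical (fitting e A) x.
Proof.
move=> [EG GA] Ex.
have /fin_all_exists[b bE] j : exists c : 'rV_n, x *: delta_mx 0 j = c *m Gm.
  exact/EG/Ex.
pose B := \matrix_j b j.
have BG : B *m Gm = x%:M.
  by apply/row_matrixP => j; rewrite row_mul rowK -bE rowE mul_mx_scalar.
(* Since [B Gm = x], the matrix [x - Gm B] annihilates [Gm], so its rows are relations. *)
have /fin_all_exists[d dE] i : exists d : 'rV_m, row i (x%:M - Gm *m B) = d *m A.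
  apply/GA; rewrite -row_mul mulmxBl -mulmxA BG mul_mx_scalar mul_scalar_mx subrr.
  by rewrite row0.
pose D := \matrix_i d i.
have xE : x%:M = row_mx D Gm *m col_mx A B.
  rewrite mul_row_col; apply/eqP; rewrite -subr_eq; apply/eqP/row_matrixP => i.
  by rewrite dE row_mul rowK.
exists n; rewrite -(det_scalar n) xE det_mulmx_rect.
have idF := fitting_ideal e A; case: (idF) => F0 _ FM.
apply: ideal_sum => // f; apply: (FM).
have [/injectiveP f_inj|/injectivePn[i1 [i2 ne_i fi]]] := boolP (injectiveb f);
  last first.
  by rewrite (determinant_alternate ne_i) // => j; rewrite !mxE fi.
pose h i := if split (f i) is inl a then Some a else None.
apply: (@fitting_det _ _ _ _ _ _ h id) => [i a|].
  by move=> + j; rewrite /h !mxE; case: split => // a' [->].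
(* An injective choice takes at most [e] rows from [B], hence at least [n - e] from [A]. *)
have sumE : (\sum_i isSome (h i) = #|[pred i | isSome (h i)]|)%N.
  by rewrite -sum1_card [RHS]big_mkcond; apply: eq_bigr => i _; rewrite inE; case: isSome.
rewrite leq_subLR sumE -{1}[n]card_ord -(cardC [pred i | isSome (h i)]) addnC leq_add2r.
rewrite -(card_imset _ f_inj) -[leqRHS]card_ord -[leqRHS](card_imset _ (@rshift_inj m e)).
apply/subset_leq_card/subsetP => _ /imsetP[i + ->]; rewrite !inE /h.
by case: splitP => // k fiE _; apply/imsetP; exists k => //; apply: val_inj.
Qed.

Definition rowspan n (Gm : 'M[R]_(n, e)) (v : 'rV[R]_e) : Prop :=
  exists c : 'rV[R]_n, v = c *m Gm.

Lemma rowspan_submod n (Gm : 'M[R]_(n, e)) : submod (rowspan Gm).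
Proof.
split=> [|_ _ [c ->] [d ->]|r _ [c ->]]; first by exists 0; rewrite mul0mx.
  by exists (c + d); rewrite mulmxDl.
by exists (r *: c); rewrite scalemxAl.
Qed.

Lemma rowspan_sub E n (Gm : 'M[R]_(n, e)) v :
  submod E -> (forall i, E (row i Gm)) -> rowspan Gm v -> E v.
Proof.
move=> [E0 ED EZ] EG [c ->]; rewrite mulmx_sum_row.
by elim/big_ind: _ => // i _; apply: EZ.
Qed.

Lemma rowspan_row n (Gm : 'M[R]_(n, e)) i : rowspan Gm (row i Gm).
Proof. by exists (delta_mx 0 i); rewrite rowE. Qed.

(* Inverting the minor [d] with columns [g], the module is generated by the at most [e]
   generators whose index is not in the image of [g]; [Y] lists them, padded with zeros. *)
Lemma minor_rowspan E n m (Gm : 'M[R]_(n, e)) (A : 'M[R]_(m, n))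
    (f : 'I_(n - e) -> 'I_m) (g : 'I_(n - e) -> 'I_n) :
  presents E Gm A -> injective g ->
  exists Y : 'M[R]_e, (forall v, rowspan Y v -> E v) /\
    forall v, E v -> rowspan Y (\det (mxsub f g A) *: v).
Proof.
move=> [EG GA] g_inj; set d := \det _.
pose s := enum [predC codom g].
have sz_s : (size s <= e)%N.
  rewrite -cardE -(leq_add2l #|codom g|) cardC card_codom // !card_ord.
  by rewrite addnC -leq_subLR.
pose Y := \matrix_i nth 0 [seq row k Gm | k <- s] i : 'M_e.
have YE v : rowspan Y v -> E v.
  have subE : submod E.
    have [G0 GD GZ] := rowspan_submod Gm; split=> [|u w /EG Eu /EG Ew|r u /EG Eu];
      apply/EG; [exact: G0 | exact: GD | exact: GZ].
  apply: rowspan_sub => // i; rewrite rowK.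
  have [lti|lei] := ltnP i (size [seq row k Gm | k <- s]).
    by have /mapP[k _ ->] := mem_nth 0 lti; apply/EG/rowspan_row.
  by rewrite nth_default //; case: subE.
exists Y; split=> //.
have subY := rowspan_submod Y; case: (subY) => Y0 YD YZ.
have Ys k : k \notin codom g -> rowspan Y (row k Gm).
  move=> kg; have ks : k \in s by rewrite mem_enum.
  have lti : (index k s < e)%N by rewrite (leq_trans _ sz_s) ?index_mem.
  have -> : row k Gm = row (Ordinal lti) Y.
    by rewrite rowK /= (nth_map k) ?index_mem // nth_index.
  exact: rowspan_row.
(* Cramer's rule: the adjugate recovers [d] times each generator in the image of [g] from the
   combinations [Z]. *)
have Yg b : rowspan Y (d *: row (g b) Gm).
  pose Z := mxsub f g A *m rowsub g Gm.
  have -> : d *: row (g b) Gm = row b (\adj (mxsub f g A) *m Z).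
    rewrite mulmxA mul_adj_mx mul_scalar_mx linearZ; congr (_ *: _).
    by apply/rowP => j; rewrite !mxE.
  apply: (@rowspan_sub _ _ Z) => //; last first.
    by exists (row b (\adj (mxsub f g A))); rewrite row_mul.
  move=> a.
  (* Relation [f a] turns row [a] of [Z] into minus a combination of the generators outside the
     image of [g]. *)
  have : row (f a) A *m Gm = 0.
    by apply/GA; exists (delta_mx 0 (f a)); rewrite rowE.
  rewrite mulmx_sum_row (bigID (mem (codom g))) /= => /eqP; rewrite addr_eq0.
  rewrite -big_uniq; last by rewrite map_inj_uniq ?enum_uniq.
  rewrite big_image /= => /eqP ZE.
  have -> : row a Z = \sum_b row (f a) A 0 (g b) *: row (g b) Gm.
    rewrite row_mul mulmx_sum_row; apply: eq_bigr => i _.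
    by rewrite !mxE; congr (_ *: _); apply/rowP => j; rewrite !mxE.
  rewrite ZE -scaleN1r; apply: (YZ).
  by elim/big_ind: _ => // k /Ys; apply: YZ.
move=> v /EG[c ->]; rewrite mulmx_sum_row scaler_sumr.
elim/big_ind: _ => // k _; rewrite scalerA mulrC -scalerA; apply: (YZ).
have [/codomP[b ->]|/Ys] := boolP (k \in codom g); last exact: YZ.
exact: Yg.
Qed.

(* With [d] a minor, [d x = B Y] and [d y = B' Y], so [det Y] divides [(d x)^e] and
   [(d y)^e]; as [x^e, y^e] is a regular sequence, [det Y] divides [d^(2 e)]. *)
Lemma fitting_ann_quot E n m (Gm : 'M[R]_(n, e)) (A : 'M[R]_(m, n)) z :
  submod E -> presents E Gm A -> grade_ge (ann_quot E) 2 -> fitting e A z ->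
  radical (ann_quot E) z.
Proof.
move=> subE pE gr2 [c ->]; have idE := ann_quot_ideal subE.
case: (idE) => E0 ED EM.
elim/big_ind: _ => [|x y|fg _]; first by exists 1%N.
  exact: radical_ideal_add.
suff [k dE] : radical (ann_quot E) (\det (mxsub fg.1 fg.2 A)).
  by exists k; rewrite exprMn; apply: EM.
(* A repeated column makes the minor zero; repeated rows need no separate treatment. *)
have [/injectiveP g_inj|/injectivePn[j1 [j2 ne_j gj]]] := boolP (injectiveb fg.2);
  last first.
  exists 1%N; rewrite -det_tr (determinant_alternate ne_j) ?expr1 // => i.
  by rewrite !mxE gj.
have [Y [YE EY]] := minor_rowspan fg.1 pE g_inj.
set d := \det _ in EY *.
(* Determinants give the exponent [e]; one more factor [d x] raises it to [e.+1], the form delivered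
   by [reg_seq_mod_exp]. *)
have det_dvd x : ann_quot E x -> exists b, d ^+ e.+1 * x ^+ e.+1 = b * \det Y.
  move=> Ex.
  have /fin_all_exists[b bE] j : rowspan Y ((d * x) *: delta_mx 0 j).
    by rewrite -scalerA; apply/EY/Ex.
  exists (d * x * \det (\matrix_j b j)); rewrite -exprMn exprS -[RHS]mulrA; congr (_ * _).
  rewrite -det_mulmx -det_scalar; congr (\det _).
  by apply/row_matrixP => j; rewrite row_mul rowK -bE rowE mul_mx_scalar.
have det_ann c' : ann_quot E (c' * \det Y).
  apply: EM => v; apply: YE; exists (v *m \adj Y).
  by rewrite -mulmxA mul_adj_mx mul_mx_scalar.
case: (grade_ge2_regular gr2) => [E1|[x [y [Ex Ey x_reg y_reg]]]].
  by exists 0%N; rewrite expr0.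
have [b bE] := det_dvd x Ex; have [b' b'E] := det_dvd y Ey.
pose K := ideal_of [::] : R -> Prop.
have idK : ideal K := ideal_of_ideal _.
have K0 u : K u -> u = 0 by case=> ? ->; rewrite big_ord0.
have Kx : reg_mod K x by move=> u /K0 /x_reg ->; case: idK.
have /= [Xreg [Wreg _]] : reg_seq_mod K [seq u ^+ e.+1 | u <- [:: x; y]].
  exact: reg_seq_mod_exp.
set X := x ^+ e.+1 in bE Xreg Wreg; set W := y ^+ e.+1 in b'E Wreg.
set q := d ^+ e.+1 in bE b'E; set D := \det Y in bE b'E det_ann.
have Xnzd u : X * u = 0 -> u = 0 by move=> Xu; apply/K0/Xreg; rewrite Xu; case: idK.
have qbW : q * (b * W - b' * X) = 0.
  have -> : q * (b * W - b' * X) = b * (q * W) - b' * (q * X) by ring.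
  rewrite bE b'E; ring.
(* Now [W (q b)] is a multiple of [X], so [q b = c' X]; then [X q^2 = q b D = c' X D], and [X]
   cancels. *)
have [|c' /K0/eqP] := Wreg (q * b).
  exists (q * b'); have -> : W * (q * b) - q * b' * X = q * (b * W - b' * X) by ring.
  by rewrite qbW; case: idK.
rewrite subr_eq0 => /eqP qb; exists (e.+1 + e.+1)%N; rewrite exprD -/q.
suff -> : q * q = c' * D by [].
apply/eqP; rewrite -subr_eq0; apply/eqP/Xnzd.
have -> : X * (q * q - c' * D) = q * (q * X) - c' * X * D by ring.
by rewrite bE mulrA qb; ring.
Qed.

End FittingIdeals.

(** * Comparison of ideals up to radical, and the theorem *)

Section SameRadical.
Variable R : comPzRingType.

Lemma in_V_radical (I J P : R -> Prop) :
  prime_ideal P -> (forall x, I x -> radical J x) -> in_V J P -> in_V I P.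
Proof. by move=> primeP IJ JP x /IJ; apply: prime_ideal_exp. Qed.

Lemma grade_eq_radical (I J : R -> Prop) :
  ideal I -> ideal J -> (forall x, I x -> radical J x) ->
  (forall x, J x -> radical I x) -> grade_eq I J.
Proof. by move=> idI idJ IJ JI k; split; apply: grade_ge_radical. Qed.

Lemma radical_trans (I J K : R -> Prop) :
  (forall x, I x -> radical J x) -> (forall x, J x -> radical K x) ->
  forall x, I x -> radical K x.
Proof.
by move=> IJ JK x /IJ[m /JK[n Kx]]; exists (m * n)%N; rewrite exprM.
Qed.

Lemma sub_radical (I J : R -> Prop) :
  (forall x, I x -> J x) -> forall x, I x -> radical J x.
Proof. by move=> IJ x /IJ; exists 1%N. Qed.

End SameRadical.

Theorem theorem3p6 (R : comPzRingType) (e : nat) (E : 'rV[R]_e -> Prop)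
  (HR : noetherian R) (He : (0 < e)%N)
  (HEsub : submod E) (HEfg : fingen E) (HEtf : torsionfree E) (HErk : rank_full E) :
  (grade_ge (ann_quot E) 2 <-> (forall U, reduction U E -> grade_ge (ann_quot U) 2)) /\
  ((forall U, reduction U E -> grade_ge (ann_quot U) 2) <->
     (exists U, reduction U E /\ grade_ge (ann_quot U) 2)) /\
  (grade_ge (ann_quot E) 2 ->
   forall U, reduction U E ->
   forall nE mE (GE : 'M[R]_(nE, e)) (AE : 'M[R]_(mE, nE))
          nU mU (GU : 'M[R]_(nU, e)) (AU : 'M[R]_(mU, nU)),
     presents E GE AE -> presents U GU AU ->
     (forall P, prime_ideal P ->
        (in_V (fitting e AE) P <-> in_V (fitting e AU) P) /\
        (in_V (fitting e AU) P <-> in_supp_quot E P) /\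
        (in_supp_quot E P <-> in_supp_quot U P)) /\
     grade_eq (ann_quot E) (fitting e AE) /\
     grade_eq (fitting e AE) (fitting e AU) /\
     grade_eq (fitting e AU) (ann_quot U)).
Proof.
have redE := reduction_refl HEsub.
have redG U : reduction U E -> grade_ge (ann_quot U) 2 <-> grade_ge (ann_quot E) 2.
  move=> redU; have [subU UE _] := redU; split; apply: grade_ge_radical.
  - exact: ann_quot_ideal.
  - by apply: sub_radical => x; apply: ann_quot_sub.
  - exact: ann_quot_ideal.
  - by move=> x; apply: reduction_radical_ann.
split; first by split=> [gE U /redG /iffRL|/(_ _ redE)//]; apply.
split; first split=> [gU|[U [redU gU]] U' redU'].
- by exists E; split=> //; apply: gU.
- by apply/(redG _ redU')/(redG _ redU).
move=> gE U redU nE mE GE AE nU mU GU AU pE pU.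
have [subU UE _] := redU; have gU : grade_ge (ann_quot U) 2 by apply/redG.
have idE := ann_quot_ideal HEsub; have idU := ann_quot_ideal subU.
have idFE := fitting_ideal e AE; have idFU := fitting_ideal e AU.
have EU x : ann_quot E x -> radical (ann_quot U) x by apply: reduction_radical_ann.
have UsubE : forall x, ann_quot U x -> radical (ann_quot E) x.
  by apply: sub_radical => x; apply: ann_quot_sub.
have EF x : ann_quot E x -> radical (fitting e AE) x by apply: ann_quot_fitting pE.
have FE x : fitting e AE x -> radical (ann_quot E) x by apply: fitting_ann_quot pE gE.
have UF x : ann_quot U x -> radical (fitting e AU) x by apply: ann_quot_fitting pU.
have FU x : fitting e AU x -> radical (ann_quot U) x by apply: fitting_ann_quot pU gU.
(* The two Fitting ideals are compared through the annihilators of [G/E] and [G/U]. *)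
have FEU := radical_trans FE (radical_trans EU UF).
have FUE := radical_trans FU (radical_trans UsubE EF).
split=> [P primeP|].
  have V := in_V_radical primeP.
  split; first by split; apply: V.
  have [suppE suppU] := (in_supp_quotE HEsub primeP, in_supp_quotE subU primeP).
  split; split.
  - by move=> FP; apply/suppE; apply: V FP; apply: radical_trans EU UF.
  - by move/suppE; apply: V; apply: radical_trans FU UsubE.
  - by move/suppE => EP; apply/suppU; apply: V EP.
  - by move/suppU => UP; apply/suppE; apply: V UP.
by split; last split; apply: grade_eq_radical.
Qed.
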